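(* Let $n\ge 3$ and let $\lambda\in\mathbb{R}^n$ satisfy $\lambda_2\ge\lambda_3\ge\dots\ge\lambda_{n-1}\ge|\lambda_n|$, with $\lambda_i-\lambda_j\in\mathbb{Z}$ and $2\lambda_i\in\mathbb{Z}$ for $2\le i,j\le n$. Suppose that $1\le\lambda_2=\dots=\lambda_p>\lambda_{p+1}$ for some $2\le p\le n$ (the condition $\lambda_p>\lambda_{p+1}$ being void if $p=n$), and that $$\lambda_1+\lambda_2\le 2+p-2n .$$ Then the Dirac inequality $$\|(\lambda-s)^++\rho\|^2\ge\|\lambda+\rho\|^2$$ holds for every Schmid module $s=s_{a,b}=(2b+a,a,0,\dots,0)$, where $a,b\ge 0$ are integers.
   Context: This is the case $\mathfrak{g}_0=\mathfrak{so}(2,2n-2)$. Here $\rho=(n-1,n-2,\dots,1,0)$ and $\|\cdot\|$ is the standard Euclidean norm on $\mathbb{R}^n$. The Weyl group $W_{\mathfrak{k}}$ is generated by the reflections in $\varepsilon_i\pm\varepsilon_j$, $2\le i<j\le n$, so it acts by permutations and even numbers of sign changes of the coordinates $2,\dots,n$ (fixing the first coordinate). For $\mu\in\mathbb{R}^n$, $\mu^+$ denotes the unique $W_{\mathfrak{k}}$-conjugate of $\mu$ satisfying $\mu_2\ge\mu_3\ge\dots\ge\mu_{n-1}\ge|\mu_n|$. Schmid modules are identified with the $n$-tuples $s_{a,b}=(2b+a,a,0,\dots,0)$ with integers $a,b\ge 0$. *)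

(* Defs.v *)
From HB Require Import structures.
From mathcomp Require Import all_boot all_order all_algebra all_fingroup.
From mathcomp Require Import boolp classical_sets reals.
Set Implicit Arguments.
Unset Strict Implicit.
Unset Printing Implicit Defensive.
Import Order.TTheory GRing.Theory Num.Theory.
Local Open Scope ring_scope.

(* 1-based coordinate: [co x k] is x_k for 1 <= k <= n. The value is 0 when k
   is out of range. *)
Definition co (R : realType) (n : nat) (x : 'rV[R]_n) (k : nat) : R :=
  \sum_(i < n | i.+1 == k) x 0 i.

Definition dotp (R : realType) (n : nat) (x y : 'rV[R]_n) : R :=
  \sum_(i < n) x 0 i * y 0 i.

(* The Euclidean norm. The library's norm on row vectors is the sup norm. *)
Definition enorm (R : realType) (n : nat) (x : 'rV[R]_n) : R :=
  Num.sqrt (dotp x x).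

(* The k-th standard basis vector, k = 1, ..., n. *)
Definition eps (R : realType) (n k : nat) : 'rV[R]_n :=
  \row_(i < n) (i.+1 == k)%:R.

(* The half sum (n-1, n-2, ..., 1, 0) of the positive roots. *)
Definition rho (R : realType) (n : nat) : 'rV[R]_n :=
  \row_(i < n) (n - i.+1)%:R.

Definition reflection (R : realType) (n : nat) (alpha x : 'rV[R]_n) : 'rV[R]_n :=
  x - (2 * dotp x alpha / dotp alpha alpha) *: alpha.

(* The Weyl group W_k, as a set of maps of R^n. Products of reflections form a
   group because reflections are involutions. *)
Inductive weyl_k (R : realType) (n : nat) : ('rV[R]_n -> 'rV[R]_n) -> Prop :=
| weyl_k_id : weyl_k id
| weyl_k_sub i j w : (2 <= i)%N -> (i < j)%N -> (j <= n)%N -> weyl_k w ->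
    weyl_k (reflection (eps R n i - eps R n j) \o w)
| weyl_k_add i j w : (2 <= i)%N -> (i < j)%N -> (j <= n)%N -> weyl_k w ->
    weyl_k (reflection (eps R n i + eps R n j) \o w).

(* x_2 >= x_3 >= ... >= x_{n-1} >= |x_n|; only meaningful for n >= 3. *)
Definition k_dominant (R : realType) (n : nat) (x : 'rV[R]_n) : Prop :=
  (forall i, (2 <= i)%N -> (i.+1 < n)%N -> co x i.+1 <= co x i) /\
  `|co x n| <= co x n.-1.

Definition k_dominant_conjugate (R : realType) (n : nat) (mu nu : 'rV[R]_n) : Prop :=
  k_dominant nu /\ exists2 w, weyl_k w & nu = w mu.

(* mu^+; the default value 0 is never used when n >= 3, by
   [k_dominant_conjugate_exists] and [k_dominant_conjugate_unique] below. *)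
Definition k_plus (R : realType) (n : nat) (mu : 'rV[R]_n) : 'rV[R]_n :=
  xget 0 [set nu | k_dominant_conjugate mu nu]%classic.

(* s_{a,b} = (2b + a, a, 0, ..., 0). *)
Definition schmid (R : realType) (n a b : nat) : 'rV[R]_n :=
  (2 * b + a)%:R *: eps R n 1 + a%:R *: eps R n 2.

Section Plus.
Variables (R : realType) (n : nat).
Implicit Types (x y mu nu : 'rV[R]_n).

Lemma co_ord x (i : 'I_n) : co x i.+1 = x 0 i.
Proof. by rewrite /co (big_pred1 i). Qed.

Lemma eps_ord (i : 'I_n) : eps R n i.+1 = delta_mx 0 i.
Proof. by apply/rowP => k; rewrite !mxE eqxx eqSS. Qed.

Definition sroot (b : bool) (i j : 'I_n) : 'rV[R]_n :=
  delta_mx 0 i + (-1) ^+ b *: delta_mx 0 j.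

Lemma dotp_delta x (i : 'I_n) : dotp x (delta_mx 0 i) = x 0 i.
Proof.
rewrite /dotp (bigD1 i) //= big1 ?addr0 ?mxE ?eqxx ?mulr1 // => k ki.
by rewrite mxE (negPf ki) andbF mulr0.
Qed.

Lemma dotpDr x y z : dotp x (y + z) = dotp x y + dotp x z.
Proof.
by rewrite /dotp -big_split; apply: eq_bigr => i _; rewrite mxE mulrDr.
Qed.

Lemma dotpZr x c y : dotp x (c *: y) = c * dotp x y.
Proof.
by rewrite /dotp big_distrr; apply: eq_bigr => i _; rewrite mxE mulrCA.
Qed.

Lemma dotpC x y : dotp x y = dotp y x.
Proof. by apply: eq_bigr => i _; rewrite mulrC. Qed.

Lemma dotp_sroot x b i j : dotp x (sroot b i j) = x 0 i + (-1) ^+ b * x 0 j.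
Proof. by rewrite dotpDr dotpZr !dotp_delta. Qed.

Lemma reflection_sroot x b (i j : 'I_n) : i != j ->
  reflection (sroot b i j) x =
  x - (x 0 i + (-1) ^+ b * x 0 j) *: sroot b i j.
Proof.
move=> ij; rewrite /reflection !dotp_sroot !mxE !eqxx /=.
rewrite (negPf ij) eq_sym (negPf ij) mulr0 addr0 add0r mulr1 -expr2 sqrr_sign.
by rewrite mulrAC divff ?mul1r // pnatr_eq0.
Qed.

Lemma reflection_srootE x b (i j : 'I_n) : i != j ->
  reflection (sroot b i j) x =
  \row_k ((if (k == i) || (k == j) then - (-1) ^+ b else 1) * x 0 (tperm i j k)).
Proof.
move=> ij; rewrite reflection_sroot //; apply/rowP => k; rewrite !mxE !eqxx /=.
case: tpermP => [->|->|/eqP ki /eqP kj].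
- rewrite eqxx (negPf ij) /= mulr0 addr0 mulr1.
  by rewrite opprD addNKr mulNr.
- rewrite eqxx [j == i]eq_sym (negPf ij) /= add0r mulr1.
  by rewrite mulrDl mulrAC -expr2 sqrr_sign mul1r opprD addrCA subrr addr0 mulNr mulrC.
- by rewrite (negPf ki) (negPf kj) /= mulr0 addr0 mulr0 subr0 mul1r.
Qed.

Lemma weyl_k_sroot b (i j : 'I_n) (w : 'rV[R]_n -> 'rV[R]_n) :
  (0 < i)%N -> (i < j)%N -> weyl_k w -> weyl_k (reflection (sroot b i j) \o w).
Proof.
move=> i0 ij hw; case: b; rewrite /sroot ?expr1 ?expr0 ?scaleN1r ?scale1r -!eps_ord.
  by apply: weyl_k_sub.
by apply: weyl_k_add.
Qed.

Lemma weyl_k_ind' (P : ('rV[R]_n -> 'rV[R]_n) -> Prop) :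
  P id ->
  (forall b (i j : 'I_n) w, (0 < i)%N -> (i < j)%N -> weyl_k w -> P w ->
     P (reflection (sroot b i j) \o w)) ->
  forall w, weyl_k w -> P w.
Proof.
move=> Pid Pst w; elim=> // -[|i] // [|j] // {}w i2 ij jn hw Pw;
  have iN : (i < n)%N by apply: leq_trans jn; apply: ltnW.
- have := Pst true (Ordinal iN) (Ordinal jn) w i2 ij hw Pw.
  by rewrite /sroot expr1 scaleN1r -!eps_ord.
- have := Pst false (Ordinal iN) (Ordinal jn) w i2 ij hw Pw.
  by rewrite /sroot expr0 scale1r -!eps_ord.
Qed.

Definition sact (p : {perm 'I_n} * {ffun 'I_n -> bool}) x : 'rV[R]_n :=
  \row_k ((-1) ^+ (p.2 k) * x 0 (p.1 k)).

(* Elements of W_k are signed permutations of the last n - 1 coordinates with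
   an even number of signs. *)
Lemma weyl_k_sact (w : 'rV[R]_n -> 'rV[R]_n) x : weyl_k w ->
  [/\ exists2 p, w x = sact p x & forall k, (0 < p.1 k)%N = (0 < k)%N,
      forall k : 'I_n, k = 0%N :> nat -> w x 0 k = x 0 k
    & \prod_(k < n | (0 < k)%N) w x 0 k = \prod_(k < n | (0 < k)%N) x 0 k].
Proof.
elim/weyl_k_ind' => {w} [|b i j w i0 ij _ [[[s e] wE /= s0] w0 wp]].
  split=> //; exists (1%g, [ffun => false]) => [|k]; last by rewrite perm1.
  by apply/rowP => k; rewrite mxE ffunE perm1 mul1r.
have nij : i != j by rewrite -val_eqE neq_ltn ij.
have j0 : (0 < j)%N by apply: leq_ltn_trans ij.
have t0 k : (0 < tperm i j k)%N = (0 < k)%N.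
  by case: tpermP => [->|->|//]; rewrite i0 j0.
rewrite /= reflection_srootE //; split.
- exists ((tperm i j * s)%g,
    [ffun k => (((k == i) || (k == j)) && ~~ b) (+) e (tperm i j k)]) => /= [|k].
    apply/rowP => k; rewrite mxE wE !mxE /= ffunE permM mulrA signr_addb.
    congr (_ * _ * _); case: ifP => //= _.
    by case: b; rewrite /= ?expr1 ?opprK.
  by rewrite permM s0 t0.
- move=> k k0.
  have ki : k != i by rewrite -val_eqE /= k0 ltn_eqF.
  have kj : k != j by rewrite -val_eqE /= k0 ltn_eqF.
  by rewrite mxE (negPf ki) (negPf kj) mul1r tpermD 1?eq_sym // w0.
- rewrite -wp; under eq_bigr do rewrite mxE.
  rewrite big_split /= [X in _ * X](_ : _ = \prod_(k < n | (0 < k)%N) w x 0 k); last first.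
    rewrite [RHS](reindex_inj (@perm_inj _ (tperm i j))) /=.
    by apply: eq_bigl => k; rewrite t0.
  rewrite (bigD1 i) //= (bigD1 j) /=; last by rewrite j0 eq_sym.
  rewrite big1 => [|k /andP[/andP[_ ki] kj]]; last by rewrite (negPf ki) (negPf kj).
  by rewrite !eqxx orbT mulr1 mulrNN -expr2 sqrr_sign mul1r.
Qed.

Hypothesis n3 : (3 <= n)%N.

Lemma k_dominantP x :
  (forall (b : bool) (i j : 'I_n), (0 < i)%N -> (i < j)%N ->
   0 <= x 0 i + (-1) ^+ b * x 0 j) -> k_dominant x.
Proof.
move=> H; split=> [[|i] // i2 iN|].
  have iN1 := ltnW iN; have iN2 := ltnW iN1.
  have := H true (Ordinal iN2) (Ordinal iN1) i2 (ltnSn _).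
  by rewrite -!co_ord mulN1r subr_ge0.
have [m nE] : exists m, n = m.+3 by exists (n - 3)%N; rewrite -addn3 subnK.
have l1 : (m.+1 < n)%N by rewrite nE ltnS leqnSn.
have l2 : (m.+2 < n)%N by rewrite nE.
have -> : co x n = co x m.+3 by congr (co x _).
have -> : co x n.-1 = co x m.+2 by congr (co x _); rewrite nE.
have H' b := H b (Ordinal l1) (Ordinal l2) (ltn0Sn _) (ltnSn _).
have := H' true; have := H' false; rewrite -!co_ord /= mul1r mulN1r.
by move=> Hp Hm; rewrite ler_norml -subr_ge0 opprK addrC Hp -subr_ge0.
Qed.

Lemma k_dominant_conjugate_exists mu : exists nu, k_dominant_conjugate mu nu.
Proof.
pose P p := `[< exists2 w, weyl_k w & sact p mu = w mu >].
have P1 : P (1%g, [ffun => false]).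
  apply/asboolP; exists id; first exact: weyl_k_id.
  by apply/rowP => k; rewrite mxE ffunE perm1 mul1r.
case: (Order.TotalTheory.arg_maxP (fun p => dotp (sact p mu) (rho R n)) P1).
move=> p /asboolP[w hw pE] pmax; exists (sact p mu); split; last by exists w.
apply: k_dominantP => b i j i0 ij; set nu := sact p mu.
have nij : i != j by rewrite -val_eqE neq_ltn ij.
have hw' := weyl_k_sroot b i0 ij hw.
have [[q qE _] _ _] := weyl_k_sact mu hw'.
have /pmax : P q by apply/asboolP; exists (reflection (sroot b i j) \o w).
rewrite -qE /= -pE -/nu reflection_sroot // ![dotp _ (rho R n)]dotpC.
rewrite dotpDr -scaleNr dotpZr gerDl mulNr oppr_le0 pmulr_lge0 //.
rewrite dotp_sroot !mxE; move: (b) => [] /=; rewrite ?expr1 ?expr0 ?mul1r ?mulN1r.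
  by rewrite subr_gt0 ltr_nat ltn_sub2l // (leq_trans _ (ltn_ord j)).
rewrite -natrD ltr0n addn_gt0 subn_gt0.
by rewrite (leq_trans _ (ltn_ord j)).
Qed.

Lemma k_dominant_ge x : k_dominant x ->
  (forall i : 'I_n, (0 < i)%N -> (i.+1 < n)%N -> `|x 0 i| = x 0 i) /\
  (forall i j : 'I_n, (0 < i)%N -> (i <= j)%N -> `|x 0 j| <= `|x 0 i|).
Proof.
move=> [H1 H2].
have key d : forall i, (0 < i)%N -> (i.+1 + d)%N = n.-1 -> `|co x n| <= co x i.+1.
  elim: d => [|d IH] i i0 id; first by rewrite addn0 in id; rewrite id.
  apply: le_trans (H1 i.+1 _ _) => //; last by rewrite -(ltn_predK n3) -id addnS !ltnS leq_addr.
  by apply: IH; rewrite // addSnnS.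
have key' i : (0 < i)%N -> (i.+1 < n)%N -> `|co x n| <= co x i.+1.
  move=> i0 iN; apply: (key (n.-1 - i.+1)%N) => //; rewrite subnKC //.
  by rewrite -ltnS (ltn_predK n3).
have pos (i : 'I_n) : (0 < i)%N -> (i.+1 < n)%N -> `|x 0 i| = x 0 i.
  move=> i0 iN; rewrite -co_ord ger0_norm //.
  by apply: le_trans (key' _ i0 iN); rewrite normr_ge0.
split=> // i j i0; have jn := ltn_ord j.
rewrite -!co_ord; move: (nat_of_ord j) jn => k.
elim: k => [|k IH] kn; first by rewrite leqn0 => /eqP i0'; rewrite i0' in i0.
rewrite leq_eqVlt => /orP[/eqP->//|]; rewrite ltnS => ik.
apply: le_trans (IH (ltnW kn) ik).
have k0 := leq_trans i0 ik.
have -> : `|co x k.+1| = co x k.+1.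
  by have := pos (Ordinal (ltnW kn)) k0 kn; rewrite -co_ord.
have := kn; rewrite leq_eqVlt => /orP[/eqP E|kn'].
  by rewrite E; apply: key'.
have -> : `|co x k.+2| = co x k.+2.
  by have := pos (Ordinal kn) isT kn'; rewrite -co_ord.
exact: H1.
Qed.

Lemma k_dominant_conjugate_unique mu nu nu' :
  k_dominant_conjugate mu nu -> k_dominant_conjugate mu nu' -> nu = nu'.
Proof.
pose I := [seq i : 'I_n <- enum 'I_n | (0 < i)%N].
have memI i : (i \in I) = (0 < i)%N by rewrite mem_filter mem_enum andbT.
have sortedI : sorted (fun i j : 'I_n => (i <= j)%N) I.
  apply: sorted_filter; first by move=> j i k; apply: leq_trans.
  by rewrite -[sorted _ _](@sorted_map _ _ val leq) val_enum_ord iota_sorted.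
have absI x : k_dominant x -> sorted >=%O [seq `|x 0 i| | i <- I].
  move=> /k_dominant_ge[_ H]; rewrite sorted_map.
  apply: (@sub_in_sorted _ [pred i : 'I_n | (0 < i)%N] _ _ _ _ _ sortedI).
    by move=> i j i0 _ ij; apply: H.
  exact: filter_all.
have permI w : weyl_k w ->
    perm_eq [seq `|w mu 0 i| | i <- I] [seq `|mu 0 i| | i <- I].
  move=> /(weyl_k_sact mu)[[[s e] -> /= s0] _ _].
  rewrite (_ : map _ I = [seq `|mu 0 i| | i <- [seq s i | i <- I]]); last first.
    rewrite -map_comp; apply: eq_map => i /=.
    by rewrite mxE normrM normr_sign mul1r.
  apply/perm_map/uniq_perm.
  - by rewrite (map_inj_uniq perm_inj) filter_uniq ?enum_uniq.
  - by rewrite filter_uniq ?enum_uniq.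
  move=> i; rewrite -[i](permKV s) (mem_map perm_inj) !memI.
  by rewrite s0.
move=> [dx [w hw xE]] [dy [w' hw' yE]].
have absE (i : 'I_n) : (0 < i)%N -> `|nu 0 i| = `|nu' 0 i|.
  have /eq_in_map E : [seq `|nu 0 i| | i <- I] = [seq `|nu' 0 i| | i <- I].
    apply: (sorted_eq ge_trans ge_anti (absI _ dx) (absI _ dy)).
    by rewrite xE yE (perm_trans (permI _ hw)) // perm_sym permI.
  by move=> i0; apply: E; rewrite memI.
have [_ nu0 nup] := weyl_k_sact mu hw; have [_ nu0' nup'] := weyl_k_sact mu hw'.
rewrite -xE in nu0 nup; rewrite -yE in nu0' nup'.
have [[posx lex] [posy _]] := (k_dominant_ge dx, k_dominant_ge dy).
have E (i : 'I_n) : (i.+1 < n)%N -> nu 0 i = nu' 0 i.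
  case: (posnP i) => [i0 _|i0 iN]; first by rewrite nu0 // nu0'.
  by rewrite -posx // -posy // absE.
apply/rowP => i; have := ltn_ord i; rewrite leq_eqVlt => /orP[/eqP iN|]; last exact: E.
have i0 : (0 < i)%N by rewrite -ltnS iN ltnW.
case: (eqVneq (nu 0 i) 0) => [x0|x0].
  by apply/eqP; rewrite x0 eq_sym -normr_eq0 -absE // x0 normr0.
have Er : \prod_(k < n | (0 < k)%N && (k != i)) nu' 0 k =
          \prod_(k < n | (0 < k)%N && (k != i)) nu 0 k.
  apply: eq_bigr => k /andP[_ ki]; rewrite -E //.
  rewrite ltn_neqAle ltn_ord andbT; apply: contra ki => /eqP kn.
  by apply/eqP/val_inj/succn_inj; rewrite /= kn iN.
move: nup; rewrite -nup' (bigD1 i) // [RHS](bigD1 i) //= Er.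
apply: mulIf; apply/prodf_neq0 => k /andP[k0 _].
rewrite -normr_gt0; apply: lt_le_trans (lex k i k0 _); first by rewrite normr_gt0.
by rewrite -ltnS iN.
Qed.

Lemma k_plusP mu : k_dominant_conjugate mu (k_plus mu).
Proof.
have [nu hnu] := k_dominant_conjugate_exists mu.
exact: (@xgetI _ 0 [set nu | k_dominant_conjugate mu nu]%classic nu hnu).
Qed.

End Plus.

(* Main.v *)
Require Import Defs.
From mathcomp Require Import all_boot all_order all_algebra.
From mathcomp Require Import reals.
From mathcomp Require Import all_fingroup boolp lra.
Import Order.TTheory GRing.Theory Num.Theory.
Local Open Scope ring_scope.

(** Write [mu = lam - s] with [s = s_{a,b}], and put [A = 2 b + a >= a] and
    [c = lam_2 = ... = lam_p]. The group [W_k] acts by isometries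
    ([dotp_weyl_k]), so the difference of the two sides of the inequality is
    [||mu||^2 - ||lam||^2 + 2 <mu^+ - lam, rho>], where only [<mu^+, rho>] is
    not explicit. Since [rho] is dominant, [mu^+] maximizes [<., rho>] on the
    orbit of [mu] ([dotp_rho_le_k_plus]), so any conjugate of [mu] gives a lower
    bound. The conjugate used is the one that moves the decreased entry [c - a]
    from position [2] to position [p], the end of the block of equal entries:
    it yields [<mu^+, rho> >= <mu, rho> + a (p - 2)].

    Substituting the upper bound for [lam_1], the difference is at least
    [2 A (c + n - 1 - p) - 2 a c + A^2 + a^2 - 2 a (n - p)].
    Because [c >= 1] and [p <= n], this is nondecreasing in [A], and at [A = a]
    it equals [2 a (a - 1)], which is nonnegative as [a] is a natural number. *)

Section DotProduct.
Variables (R : realType) (n : nat).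
Implicit Types x y : 'rV[R]_n.

Lemma dotp_ge0 x : 0 <= dotp x x.
Proof. by apply: sumr_ge0 => i _; rewrite -expr2 sqr_ge0. Qed.

Lemma enorm_sqr x : enorm x ^+ 2 = dotp x x.
Proof. by rewrite /enorm sqr_sqrtr ?dotp_ge0. Qed.

Lemma dotpNr x y : dotp x (- y) = - dotp x y.
Proof. by rewrite -scaleN1r dotpZr mulN1r. Qed.

Lemma dotpDD x y : dotp (x + y) (x + y) = dotp x x + 2 * dotp x y + dotp y y.
Proof. by rewrite dotpDr ![dotp (x + y) _]dotpC !dotpDr (dotpC y x); lra. Qed.

Lemma dotp_weyl_k (w : 'rV[R]_n -> 'rV[R]_n) x :
  weyl_k w -> dotp (w x) (w x) = dotp x x.
Proof.
move=> /(weyl_k_sact x)[[[s e] -> _] _ _].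
rewrite [RHS](reindex_inj (@perm_inj _ s)); apply: eq_bigr => k _.
by rewrite !mxE /= mulrACA -expr2 sqrr_sign mul1r.
Qed.

Lemma dotp_reflection_rho x b (i j : 'I_n) : i != j ->
  dotp (reflection (sroot R b i j) x) (rho R n) =
  dotp x (rho R n) - dotp x (sroot R b i j) * dotp (rho R n) (sroot R b i j).
Proof.
move=> ij; rewrite reflection_sroot // dotpC dotpDr dotpNr dotpZr.
by rewrite (dotpC (rho R n) x) !dotp_sroot.
Qed.

Lemma dotp_rho_sroot_gt0 b (i j : 'I_n) :
  (i < j)%N -> 0 < dotp (rho R n) (sroot R b i j).
Proof.
move=> ij; have jn := ltn_ord j; rewrite dotp_sroot !mxE.
case: b; rewrite ?expr1 ?expr0 ?mul1r ?mulN1r.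
  by rewrite subr_gt0 ltr_nat ltn_sub2l // (leq_trans _ jn).
by rewrite -natrD ltr0n addn_gt0 subn_gt0 (leq_trans _ jn).
Qed.

(** The orbit of [x] is finite, as it consists of images under signed
    permutations, so [<., rho>] attains its maximum on it. A maximizer is
    dominant, because reflecting it in a positive root on which it were negative
    would increase the pairing; by uniqueness it is [x^+]. *)
Lemma dotp_rho_le_k_plus (w : 'rV[R]_n -> 'rV[R]_n) x : (3 <= n)%N ->
  weyl_k w -> dotp (w x) (rho R n) <= dotp (k_plus x) (rho R n).
Proof.
move=> n3 hw; pose P p := `[< exists2 v, weyl_k v & sact p x = v x >].
have sactP v : weyl_k v -> exists2 p, P p & v x = sact p x.
  move=> hv; have [[p vE _] _ _] := weyl_k_sact x hv.
  by exists p => //; apply/asboolP; exists v.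
have [p0 Pp0 wE] := sactP w hw.
case: (Order.TotalTheory.arg_maxP (fun p => dotp (sact p x) (rho R n)) Pp0).
move=> p /asboolP[v hv vE] pmax.
suff -> : k_plus x = sact p x by rewrite wE; apply: pmax.
apply: (k_dominant_conjugate_unique n3 (k_plusP n3 x)).
split; last by exists v.
apply: (k_dominantP n3) => b i j i0 ij.
have [q Pq qE] := sactP _ (weyl_k_sroot b i0 ij hv).
have := pmax q Pq; rewrite -qE /= -vE dotp_reflection_rho; last first.
  by rewrite -val_eqE neq_ltn ij.
by rewrite gerDl oppr_le0 pmulr_lge0 ?dotp_rho_sroot_gt0 // dotp_sroot.
Qed.

(** Test the maximality of [x^+] on the transposition of the coordinates
    [i] and [j]. *)
Lemma dotp_rho_transposition (i j : 'I_n) x : (3 <= n)%N ->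
  (0 < i <= j)%N ->
  dotp x (rho R n) + (x 0 j - x 0 i) * (j%:R - i%:R) <=
  dotp (k_plus x) (rho R n).
Proof.
move=> n3 /andP[i0]; rewrite leq_eqVlt => /orP[/eqP/val_inj<-|ij].
  rewrite !subrr mul0r addr0.
  exact: (dotp_rho_le_k_plus id x n3 (weyl_k_id R n)).
have := dotp_rho_le_k_plus _ x n3 (weyl_k_sroot true i0 ij (weyl_k_id R n)).
rewrite /= dotp_reflection_rho; last by rewrite -val_eqE neq_ltn ij.
rewrite !dotp_sroot !mxE !natrB ?ltn_ord // expr1 -!natr1.
by apply: le_trans; rewrite lerD2l; lra.
Qed.

End DotProduct.

Theorem theorem3p82 (R : realType) (n : nat) (hn : (3 <= n)%N)
    (lam : 'rV[R]_n) (p : nat)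
    (hdom : k_dominant lam)
    (hdiff : forall i j, (2 <= i <= n)%N -> (2 <= j <= n)%N ->
       co lam i - co lam j \is a Num.int)
    (hhalf : forall i, (2 <= i <= n)%N -> 2 * co lam i \is a Num.int)
    (hp : (2 <= p <= n)%N)
    (hge1 : 1 <= co lam 2)
    (heq : forall i, (2 <= i <= p)%N -> co lam i = co lam 2)
    (hgt : (p < n)%N -> co lam p.+1 < co lam p)
    (hle : co lam 1 + co lam 2 <= 2 + p%:R - 2 * n%:R) :
  forall a b : nat,
    enorm (lam + rho R n) ^+ 2 <=
    enorm (k_plus (lam - schmid R n a b) + rho R n) ^+ 2.
Proof.
move=> a b; set s := schmid R n a b; set mu := lam - s.
case: p hp heq hgt hle => // q /andP[q1 qn] heq _ hle.
have n1 : (0 < n)%N by apply: leq_trans hn.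
have n2 : (1 < n)%N by apply: leq_trans hn.
pose i1 := Ordinal n1; pose i2 := Ordinal n2; pose ip := Ordinal qn.
set A : R := (2 * b + a)%:R; set a' : R := a%:R.
have dotps x : dotp x s = A * x 0 i1 + a' * x 0 i2.
  rewrite /s /schmid dotpDr !dotpZr.
  by rewrite (eps_ord R i1) (eps_ord R i2) !dotp_delta.
have sE k : s 0 k = A * (k == i1)%:R + a' * (k == i2)%:R.
  by rewrite !mxE -!val_eqE /= !eqSS.
have ss : dotp s s = A ^+ 2 + a' ^+ 2.
  by rewrite dotps !sE !eqxx /=; lra.
have rs : dotp (rho R n) s = A * (n%:R - 1) + a' * (n%:R - 2).
  by rewrite dotps !mxE /= !natrB.
have lamE : lam 0 ip = lam 0 i2.
  by rewrite -!co_ord; apply: heq; rewrite /= leqnn andbT.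
(* The entries differ by [a] unless [p = 2], where the transposition is trivial
   and the other factor vanishes. *)
have mu_diff : (mu 0 ip - mu 0 i2) * (q%:R - 1) = a' * (q%:R - 1) :> R.
  have muE k : mu 0 k = lam 0 k - s 0 k by rewrite mxE [(- s) _ _]mxE.
  rewrite !muE !sE lamE -!val_eqE /= (gtn_eqF (q1 : (0 < q)%N)).
  by have [->|_] := eqVneq q 1%N; rewrite ?subrr ?mulr0 //=; lra.
have := dotp_rho_transposition R n i2 ip mu hn q1.
rewrite /= mu_diff => mu_plus.
have [_ [w hw plusE]] := k_plusP hn mu.
have plus_sq : dotp (k_plus mu) (k_plus mu) = dotp mu mu.
  by rewrite plusE dotp_weyl_k.
have mu_sq : dotp mu mu =
    dotp lam lam - 2 * (A * lam 0 i1 + a' * lam 0 i2) + A ^+ 2 + a' ^+ 2.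
  by rewrite dotpDD !dotpNr dotps [dotp (- s) s]dotpC dotpNr ss; lra.
have mu_rho : dotp mu (rho R n) =
    dotp lam (rho R n) - (A * (n%:R - 1) + a' * (n%:R - 2)).
  by rewrite dotpC dotpDr dotpNr rs dotpC.
have lam2 : 1 <= lam 0 i2 by rewrite -co_ord.
have lam1 : lam 0 i1 + lam 0 i2 <= 2 + (q%:R + 1) - 2 * n%:R.
  by rewrite -!co_ord natr1.
have qn' : q%:R + 1 <= n%:R :> R by rewrite natr1 ler_nat.
have a0 : 0 <= a' by [].
have aA : a' <= A by rewrite ler_nat leq_addl.
have sqA : a' ^+ 2 <= A ^+ 2 by rewrite lerXn2r ?nnegrE //; lra.
have sqa : a' <= a' ^+ 2.
  by rewrite -natrX ler_nat; case: (a) => // k; rewrite leq_pmulr.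
(* The upper bound on [lam_1], weighted by its coefficient [A] in [<lam, s>]. *)
have A_lam1 : 0 <= A * (2 + (q%:R + 1) - 2 * n%:R - (lam 0 i1 + lam 0 i2)).
  by apply: mulr_ge0; lra.
(* The reduction from [A] to [a], the part of the estimate linear in [A]. *)
have A_mono : 0 <= (A - a') * (lam 0 i2 + n%:R - 1 - (q%:R + 1)).
  by apply: mulr_ge0; lra.
rewrite !enorm_sqr !dotpDD plus_sq mu_sq.
lra.
Qed.
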